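(* Let $P\subset\mathbb{R}^3$ be a compact convex polyhedron with triangular faces, with $0$ in its interior and vertices $p_1,\dots,p_n$. Let $r\in U$ and let $\dot r\in\mathbb{R}^n$ be arbitrary. Then the second variation $\operatorname{HE}^{\cdot\cdot}=\frac{d^2}{dt^2}\big|_{t=0}\operatorname{HE}(r+t\dot r)$ of the discrete Hilbert-Einstein functional of the warped polyhedron $P(r)$ is given by any of the following two formulas: $$\operatorname{HE}^{\cdot\cdot}=\sum_i\dot r_i\dot\kappa_i,\qquad \operatorname{HE}^{\cdot\cdot}=\sum_i r_i\sum_j\dot s_{ij}\dot\lambda_{ij}.$$ Here $j$ runs over all indices such that $p_ip_j$ is an edge of $P$.
   Context: Put $r^0_i=\|p_i\|$ and $\ell_{ij}=\|p_i-p_j\|$ for every edge $p_ip_j$ of $P$. Cut $P$ into triangular pyramids with apex $0$ over the faces. For $r$ in a sufficiently small neighborhood $U\subset\mathbb{R}^n$ of $r^0$, replace the pyramid over each face $p_ip_jp_k$ by the Euclidean tetrahedron with lateral edge lengths $r_i,r_j,r_k$ and base edge lengths $\ell_{ij},\ell_{jk},\ell_{ik}$, and glue by the old rules; the result is the warped polyhedron $P(r)$. Functions of $r$: $\kappa_i=2\pi-\omega_i$, where $\omega_i$ is the sum of all dihedral angles at the lateral edge $0p_i$; $\lambda_{ij}=\lambda_{ji}$ is the exterior dihedral angle at the boundary edge $p_ip_j$ ($\pi$ minus the sum of the dihedral angles at $p_ip_j$ of the two tetrahedra containing it); $s_{ij}=\cos\rho_{ij}$, where $\rho_{ij}$ is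 the angle at $p_i$ in the triangle $0p_ip_j$ with side lengths $r_i,r_j,\ell_{ij}$. The discrete Hilbert-Einstein functional is $\operatorname{HE}(r)=\sum_i r_i\kappa_i+\sum_{\{i,j\}}\ell_{ij}\lambda_{ij}$, the second sum being over boundary edges, each taken once. A dot over a function of $r$ denotes its derivative at $r$ in the direction $\dot r$. *)

(* Defs.v *)
From HB Require Import structures.
From mathcomp Require Import all_boot all_order all_algebra.
From mathcomp Require Import all_classical all_reals all_analysis.
Set Implicit Arguments. Unset Strict Implicit. Unset Printing Implicit Defensive.
Import Order.TTheory GRing.Theory Num.Theory.
Import numFieldNormedType.Exports.
Local Open Scope classical_set_scope.
Local Open Scope ring_scope.

Section Euclidean.
Context {R : realType}.
Implicit Types u v o a b c x y z w : 'rV[R]_3.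

Definition dotp u v : R := \sum_k u 0 k * v 0 k.

(* The library norm [`|u|] on row vectors is the sup norm. *)
Definition enorm u : R := Num.sqrt (dotp u u).

Definition vangle u v : R := acos (dotp u v / (enorm u * enorm v)).

Definition reject u v : 'rV[R]_3 := v - (dotp u v / dotp u u) *: u.

(* Interior dihedral angle of the tetrahedron xyzw at the edge xy, that is, the
   angle between the half-planes bounded by the line xy through z and w. *)
Definition dihedral x y z w : R :=
  vangle (reject (y - x) (z - x)) (reject (y - x) (w - x)).

Definition nondegenerate o a b c : Prop :=
  \rank (col_mx (a - o) (col_mx (b - o) (c - o))) = 3%N.

End Euclidean.

Section Polyhedron.
Context {R : realType} {n : nat}.
Variable p : 'I_n -> 'rV[R]_3.

Definition polytope : set 'rV[R]_3 :=
  [set x | exists2 w : 'I_n -> R,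
     (forall i, 0 <= w i) /\ \sum_i w i = 1 & x = \sum_i w i *: p i].

(* A proper face is the intersection of the polytope with a supporting plane
   [dotp u x = c]; it is encoded by the set of indices i such that p i lies in
   that plane. *)
Definition face (F : {set 'I_n}) : Prop :=
  exists u c, [/\ u != 0, F != finset.set0,
    forall x, polytope x -> dotp u x <= c
    & F = [set i | dotp u (p i) == c]%SET].

Definition facet (F : {set 'I_n}) : Prop :=
  face F /\ exists i j k : 'I_n, [/\ i \in F, j \in F, k \in F
    & \rank (col_mx (p j - p i) (p k - p i)) = 2%N].

(* When every facet carries exactly three of the vertices, every facet is a
   triangle.  The condition on singletons makes the p i the pairwise distinct
   vertices of the polytope. *)
Definition triangular_polyhedron : Prop :=
  (forall i, face [set i]%SET) /\ (forall F, facet F -> #|F| = 3%N).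

Definition edge (i j : 'I_n) : bool :=
  (i != j) && `[< face [set i; j]%SET >].

Definition triangle (i j k : 'I_n) : bool := `[< facet [set i; j; k]%SET >].

Definition ell (i j : 'I_n) : R := enorm (p i - p j).

Definition r0 : 'rV[R]_n := \row_i enorm (p i).

(* Euclidean tetrahedra with apex o that replace the pyramid over p_i p_j p_k *)
Definition pyramid (r : 'rV[R]_n) (i j k : 'I_n) (o a b c : 'rV[R]_3) : Prop :=
  [/\ nondegenerate o a b c,
      [/\ enorm (a - o) = r 0 i, enorm (b - o) = r 0 j & enorm (c - o) = r 0 k]
    & [/\ enorm (a - b) = ell i j, enorm (b - c) = ell j k
        & enorm (a - c) = ell i k]].

(* The values of r for which the warped polyhedron P(r) is defined *)
Definition warped_domain : set 'rV[R]_n :=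
  [set r | forall i j k, triangle i j k ->
     exists o a b c, pyramid r i j k o a b c].

(* Dihedral angles of that tetrahedron at the edges 0p_i and p_ip_j; they do not
   depend on the realization since the edge lengths determine it up to
   isometry. *)
Definition lateral_angle (i j k : 'I_n) (r : 'rV[R]_n) : R :=
  get [set t | exists o a b c,
         pyramid r i j k o a b c /\ t = dihedral o a b c].

Definition base_angle (i j k : 'I_n) (r : 'rV[R]_n) : R :=
  get [set t | exists o a b c,
         pyramid r i j k o a b c /\ t = dihedral a b o c].

Definition omega (i : 'I_n) (r : 'rV[R]_n) : R :=
  \sum_(j < n) \sum_(k < n | (j < k)%N && triangle i j k) lateral_angle i j k r.

Definition kappa (i : 'I_n) (r : 'rV[R]_n) : R := 2 * pi - omega i r.

Definition lambda (i j : 'I_n) (r : 'rV[R]_n) : R :=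
  pi - \sum_(k < n | triangle i j k) base_angle i j k r.

(* Angle at p_i in a triangle 0p_ip_j with side lengths r_i, r_j, ell_ij *)
Definition rho (i j : 'I_n) (r : 'rV[R]_n) : R :=
  get [set t | exists o a b : 'rV[R]_3,
         [/\ enorm (a - o) = r 0 i, enorm (b - o) = r 0 j,
             enorm (a - b) = ell i j & t = vangle (o - a) (b - a)]].

Definition s (i j : 'I_n) (r : 'rV[R]_n) : R := cos (rho i j r).

Definition HE (r : 'rV[R]_n) : R :=
  \sum_i r 0 i * kappa i r
  + \sum_(i < n) \sum_(j < n | (i < j)%N && edge i j) ell i j * lambda i j r.

End Polyhedron.

(* [derive1 f] is a total function, so that f has to be required to be derivable
   around t. *)
Definition is_second_derive {R : realType} (f : R -> R) (t l : R) : Prop :=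
  (\forall x \near t, derivable f x 1) /\ is_derive t 1 (derive1 f) l.

(* Main.v *)
(* The spherical law of cosines expresses the dihedral angles of the tetrahedron
   over a face through s_ij = cos rho_ij.  In the spherical triangle cut out at
   p_i, the side inside the face p_ip_jp_k has constant length, so that the angle
   alpha at 0p_i and the angles beta_j, beta_k at p_ip_j, p_ip_k satisfy
   alpha' + s_ij beta_j' + s_ik beta_k' = 0.  Summing over the faces at p_i gives
   kappa_i' + sum_j s_ij lambda_ij' = 0.  Together with
   l_ij = r_i s_ij + r_j s_ji this yields Schlaefli's formula
   sum_i r_i kappa_i' + sum_ij l_ij lambda_ij' = 0, hence HE' = sum_i r_i' kappa_i
   and the first formula.  Differentiating l_ij = r_i s_ij + r_j s_ji turns
   sum_i r_i' kappa_i' = - sum_i r_i' sum_j s_ij lambda_ij' into the second one. *)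
Require Import Defs.
From mathcomp Require Import all_boot all_order all_algebra.
From mathcomp Require Import all_classical all_reals all_analysis.
From mathcomp Require Import ring.
Import Order.TTheory GRing.Theory Num.Theory.
Import numFieldNormedType.Exports.
Set Implicit Arguments.
Unset Strict Implicit.
Unset Printing Implicit Defensive.
Local Open Scope classical_set_scope.
Local Open Scope ring_scope.

(** * Vectors, angles and dihedral angles in 3-space *)

Section VectorAlgebra.
Context {R : realType}.
Implicit Types u v w x y z : 'rV[R]_3.

Lemma dotpE u v :
  dotp u v = u 0 0 * v 0 0 + u 0 1 * v 0 1 + u 0 2 * v 0 2.
Proof.
rewrite /dotp !big_ord_recl big_ord0 addr0 addrA.
by congr (_ + u 0 _ * v 0 _ + u 0 _ * v 0 _); apply/val_inj.
Qed.

Definition crossp u v : 'rV[R]_3 :=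
  \row_k [:: u 0 1 * v 0 2 - u 0 2 * v 0 1; u 0 2 * v 0 0 - u 0 0 * v 0 2;
             u 0 0 * v 0 1 - u 0 1 * v 0 0]`_k.

Definition det3 u v w : R := dotp (crossp u v) w.

Lemma crosspE u v :
  (crossp u v 0 0 = u 0 1 * v 0 2 - u 0 2 * v 0 1) *
  (crossp u v 0 1 = u 0 2 * v 0 0 - u 0 0 * v 0 2) *
  (crossp u v 0 2 = u 0 0 * v 0 1 - u 0 1 * v 0 0).
Proof. by rewrite !mxE. Qed.

Let coordE := (dotpE, crosspE, mxE).

Lemma dotpC u v : dotp u v = dotp v u.
Proof. by rewrite !dotpE; ring. Qed.

Lemma dotpDr u v w : dotp u (v + w) = dotp u v + dotp u w.
Proof. by rewrite !coordE; ring. Qed.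

Lemma dotpDl u v w : dotp (u + v) w = dotp u w + dotp v w.
Proof. by rewrite !coordE; ring. Qed.

Lemma dotpNr u v : dotp u (- v) = - dotp u v.
Proof. by rewrite !coordE; ring. Qed.

Lemma dotpNl u v : dotp (- u) v = - dotp u v.
Proof. by rewrite !coordE; ring. Qed.

Lemma dotpZr u v a : dotp u (a *: v) = a * dotp u v.
Proof. by rewrite !coordE; ring. Qed.

Lemma dotpZl u v a : dotp (a *: u) v = a * dotp u v.
Proof. by rewrite !coordE; ring. Qed.

Lemma dotp0 u : dotp u 0 = 0.
Proof. by rewrite !coordE; ring. Qed.

Lemma dotp_sumr n u (w : 'I_n -> R) (f : 'I_n -> 'rV[R]_3) :
  dotp u (\sum_i w i *: f i) = \sum_i w i * dotp u (f i).
Proof.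
elim/big_ind2: _ => [|x a y b <- <-|i _]; first exact: dotp0.
  by rewrite dotpDr.
by rewrite dotpZr.
Qed.

Lemma crossp_dotl u v : dotp (crossp u v) u = 0.
Proof. by rewrite !coordE; ring. Qed.

Lemma crossp_dotr u v : dotp (crossp u v) v = 0.
Proof. by rewrite !coordE; ring. Qed.

Lemma dotp_ge0 u : 0 <= dotp u u.
Proof. by rewrite !coordE -!expr2 !addr_ge0 ?sqr_ge0. Qed.

Lemma row3P u v : u 0 0 = v 0 0 -> u 0 1 = v 0 1 -> u 0 2 = v 0 2 -> u = v.
Proof.
move=> h0 h1 h2; apply/rowP => -[[|[|[|//]]] lt3].
- by rewrite (_ : Ordinal lt3 = 0) //; apply: val_inj.
- by rewrite (_ : Ordinal lt3 = 1) //; apply: val_inj.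
- by rewrite (_ : Ordinal lt3 = 2) //; apply: val_inj.
Qed.

Lemma dotp_eq0 u : (dotp u u == 0) = (u == 0).
Proof.
apply/eqP/eqP => [|->]; last exact: dotp0.
rewrite dotpE -!expr2 => /eqP.
rewrite paddr_eq0 ?addr_ge0 ?sqr_ge0// paddr_eq0 ?sqr_ge0// !sqrf_eq0.
by move=> /andP[/andP[/eqP h0 /eqP h1] /eqP h2]; apply: row3P; rewrite mxE.
Qed.

Lemma dotp_gt0 u : (0 < dotp u u) = (u != 0).
Proof. by rewrite lt_def dotp_ge0 andbT dotp_eq0. Qed.

Lemma lagrange u v :
  dotp (crossp u v) (crossp u v) = dotp u u * dotp v v - dotp u v ^+ 2.
Proof. by rewrite !coordE; ring. Qed.

Lemma sqr_enorm u : enorm u ^+ 2 = dotp u u.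
Proof. by rewrite sqr_sqrtr// dotp_ge0. Qed.

Lemma enorm_ge0 u : 0 <= enorm u. Proof. exact: sqrtr_ge0. Qed.

Lemma enorm_gt0 u : (0 < enorm u) = (u != 0).
Proof. by rewrite sqrtr_gt0 dotp_gt0. Qed.

Lemma enormN u : enorm (- u) = enorm u.
Proof. by rewrite /enorm dotpNl dotpNr opprK. Qed.

Lemma enorm_distC u v : enorm (u - v) = enorm (v - u).
Proof. by rewrite -enormN opprB. Qed.

Lemma enorm_eq u (l : R) : 0 <= l -> dotp u u = l ^+ 2 -> enorm u = l.
Proof. by move=> l0 h; rewrite /enorm h sqrtr_sqr ger0_norm. Qed.

(** The determinant of the symmetric matrix with diagonal [uu], [vv], [ww] and off-diagonal entries
    [uv], [uw], [vw]. *)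
Definition gram3 (uu vv ww uv uw vw : R) : R :=
  uu * vv * ww + 2 * uv * uw * vw - uu * vw ^+ 2 - vv * uw ^+ 2 - ww * uv ^+ 2.

Lemma sqr_det3 u v w : det3 u v w ^+ 2 =
  gram3 (dotp u u) (dotp v v) (dotp w w) (dotp u v) (dotp u w) (dotp v w).
Proof. by rewrite /det3 /gram3 !coordE; ring. Qed.

Lemma det3_neq0 u v w : det3 u v w != 0 -> [/\ u != 0, v != 0 & w != 0].
Proof.
by move=> h; split; apply: contraNneq h => ->;
  rewrite /det3 !coordE; apply/eqP; ring.
Qed.

Lemma det3C12 u v w : det3 v u w = - det3 u v w.
Proof. by rewrite /det3 !coordE; ring. Qed.

Lemma det3C23 u v w : det3 u w v = - det3 u v w.
Proof. by rewrite /det3 !coordE; ring. Qed.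

Lemma det3_crossp u v w : det3 u v w != 0 -> crossp u v != 0.
Proof.
by apply: contraNneq => h; rewrite /det3 h dotpC dotp0.
Qed.

Lemma coord_nth u (k : 'I_3) : u 0 k = [:: u 0 0; u 0 1; u 0 2]`_k.
Proof.
by case: k => -[|[|[|//]]] lt3 /=; congr (u 0 _); apply: val_inj.
Qed.

(** [det3] is the determinant of the matrix with these rows, and a square matrix has full rank
    exactly when its determinant is nonzero. *)
Lemma rank_col_mx3 u v w :
  (\rank (col_mx u (col_mx v w)) = 3%N) <-> det3 u v w != 0.
Proof.
pose M : 'M[R]_3 := (col_mx u (col_mx v w) : 'M[R]_(1 + (1 + 1), 3)).
rewrite -[col_mx u _]/M.
have -> : det3 u v w = \det M.
  rewrite /det3 dotpE !crosspE.
  have M0 k : M 0 k = [:: u 0 0; u 0 1; u 0 2]`_k.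
    rewrite -(coord_nth u).
    have -> : 0 = lshift 2 (0 : 'I_1) :> 'I_3 by apply: val_inj.
    exact: (@col_mxEu R 1 2 3).
  have M1 k : M 1 k = [:: v 0 0; v 0 1; v 0 2]`_k.
    rewrite -(coord_nth v).
    have -> : 1 = rshift 1 (lshift 1 (0 : 'I_1)) :> 'I_3 by apply: val_inj.
    by apply: etrans (@col_mxEd R 1 2 3 _ _ _ _) _; exact: (@col_mxEu R 1 1 3).
  have M2 k : M 2 k = [:: w 0 0; w 0 1; w 0 2]`_k.
    rewrite -(coord_nth w).
    have -> : 2 = rshift 1 (rshift 1 (0 : 'I_1)) :> 'I_3 by apply: val_inj.
    by apply: etrans (@col_mxEd R 1 2 3 _ _ _ _) _; exact: (@col_mxEd R 1 1 3).
  clearbody M.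
  rewrite (expand_det_row _ 0) !big_ord_recl big_ord0 /cofactor.
  rewrite !(expand_det_row _ 0) !big_ord_recl !big_ord0 /cofactor !det_mx11 !mxE.
  have -> : lift 0 (lift 0 0) = 2 :> 'I_3 by apply: val_inj.
  have -> : lift 0 0 = 1 :> 'I_3 by apply: val_inj.
  by rewrite !M0 !M1 !M2 /= /bump /=; ring.
rewrite -unitfE -[_ \in _]/(_ \in unitmx) -row_free_unit /row_free.
by split => [->//|/eqP].
Qed.

Lemma double_crossp u v :
  dotp v v *: u - dotp u v *: v = crossp v (crossp u v).
Proof. by apply: row3P; rewrite !coordE; ring. Qed.

(** If the cross product vanishes, [double_crossp] is a linear relation between [u] and [v]. If not,
    it completes them to three independent rows, and a single row raises the rank by at most one. *)
Lemma rank_col_mx2 u v : (\rank (col_mx u v) = 2%N) <-> crossp u v != 0.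
Proof.
split=> [rk2|w0].
  have rf : row_free (col_mx u v) by rewrite /row_free rk2.
  apply/eqP => w0.
  have combo0 (a b : R) : a *: u + b *: v = 0 -> a = 0 /\ b = 0.
    move=> ab0; have : row_mx a%:M b%:M = 0 :> 'rV[R]_(1 + 1).
      by apply: (row_free_inj rf); rewrite mul0mx mul_row_col !mul_scalar_mx.
    move=> /eqP; rewrite row_mx_eq0 => /andP[/eqP/matrixP/(_ 0 0) + /eqP/matrixP/(_ 0 0)].
    by rewrite !mxE.
  have [vv0 _] : dotp v v = 0 /\ - dotp u v = 0.
    apply: combo0; rewrite scaleNr double_crossp w0.
    by apply: row3P; rewrite !coordE; ring.
  have [_ /eqP] : 0 = 0 :> R /\ 1 = 0 :> R.
    by apply: combo0; move/eqP: vv0; rewrite dotp_eq0 => /eqP ->; rewrite scale0r scaler0 addr0.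
  by rewrite oner_eq0.
have rk3 : \rank (col_mx (crossp u v) (col_mx u v)) = 3%N.
  apply/rank_col_mx3; rewrite (_ : det3 _ _ _ = dotp (crossp u v) (crossp u v)).
    by rewrite dotp_eq0.
  by rewrite /det3 !coordE; ring.
apply/eqP; rewrite eqn_leq rank_leq_row /=.
have := (mxrank_adds_leqif (crossp u v) (col_mx u v)).1.
rewrite addsmxE rk3 => h.
by rewrite -ltnS; apply: (leq_trans h); exact: (leq_add (rank_leq_row _) (leqnn _)).
Qed.

(** * Cosines of angles and the spherical law of cosines *)

Definition cosang u v : R := dotp u v / (enorm u * enorm v).

Lemma cosangC u v : cosang u v = cosang v u.
Proof. by rewrite /cosang dotpC mulrC [RHS]mulrC [enorm v * _]mulrC. Qed.

(** The cosine of the angle between the sides [x] and [y] of a plane triangle with third side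
    [z]. *)
Definition lawcos (x y z : R) : R := (x ^+ 2 + y ^+ 2 - z ^+ 2) / (2 * x * y).

Lemma cosang_lawcos u v : cosang u v = lawcos (enorm u) (enorm v) (enorm (u - v)).
Proof.
rewrite /lawcos !sqr_enorm -mulrA invfM mulrA; congr (_ / _).
by rewrite dotpDl !dotpDr !dotpNr !dotpNl (dotpC v u); field.
Qed.

Lemma dotp_cosang u v : dotp u v = cosang u v * (enorm u * enorm v).
Proof.
have [->|u0] := eqVneq u 0; first by rewrite /cosang dotpC dotp0 !mul0r.
have [->|v0] := eqVneq v 0; first by rewrite /cosang dotp0 !mul0r.
by rewrite divfK// mulf_neq0// gt_eqF// enorm_gt0.
Qed.

Lemma cosang_sqr_lt1 u v : crossp u v != 0 -> cosang u v ^+ 2 < 1.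
Proof.
move=> w0; have w_gt0 : 0 < dotp (crossp u v) (crossp u v) by rewrite dotp_gt0.
move: w_gt0; rewrite lagrange (dotp_cosang u v) -!sqr_enorm => h.
have m_gt0 : 0 < (enorm u * enorm v) ^+ 2.
  rewrite lt_def sqr_ge0 andbT; apply: contraTneq h => m0.
  by rewrite -[X in X - _]exprMn [X in _ - X]exprMn m0 mulr0 subr0 ltxx.
by rewrite -subr_gt0 -(pmulr_lgt0 _ m_gt0) mulrBl mul1r -exprMn [X in X - _]exprMn.
Qed.

Lemma cosang_sqr_le1 u v : cosang u v ^+ 2 <= 1.
Proof.
have [w0|/cosang_sqr_lt1/ltW//] := eqVneq (crossp u v) 0.
have [->|u0] := eqVneq u 0; first by rewrite /cosang dotpC dotp0 !mul0r expr0n ler01.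
have [->|v0] := eqVneq v 0; first by rewrite /cosang dotp0 !mul0r expr0n ler01.
have := lagrange u v; rewrite w0 dotp0 -!sqr_enorm => /esym/subr0_eq h.
by rewrite /cosang expr_div_n exprMn h divff// -h mulf_neq0// expf_neq0// gt_eqF// enorm_gt0.
Qed.

(** The Gram determinant of three unit vectors with pairwise cosines [x], [y], [z]. *)
Definition gramc (x y z : R) : R := 1 + 2 * x * y * z - x ^+ 2 - y ^+ 2 - z ^+ 2.

Lemma sqr_det3_gramc u v w : det3 u v w ^+ 2 =
  gramc (cosang u v) (cosang u w) (cosang v w) * (enorm u * enorm v * enorm w) ^+ 2.
Proof.
rewrite sqr_det3 /gram3 (dotp_cosang u v) (dotp_cosang u w) (dotp_cosang v w).
by rewrite -!sqr_enorm /gramc; ring.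
Qed.

Lemma gramc_gt0 u v w : det3 u v w != 0 ->
  0 < gramc (cosang u v) (cosang u w) (cosang v w).
Proof.
move=> h; have h2 : 0 < det3 u v w ^+ 2 by rewrite exprn_even_gt0.
have [u0 v0 w0] := det3_neq0 h.
move: h2; rewrite sqr_det3_gramc pmulr_lgt0// exprn_even_gt0//= !mulf_neq0// gt_eqF// enorm_gt0//.
Qed.

(* The angle of a spherical triangle between two sides with cosines x and y
   opposite to a side with cosine z. *)
Definition sphangle (x y z : R) : R :=
  acos ((z - x * y) / (Num.sqrt (1 - x ^+ 2) * Num.sqrt (1 - y ^+ 2))).

Lemma dotp_reject e u v : e != 0 -> u != 0 -> v != 0 ->
  dotp (reject e u) (reject e v) =
  (cosang u v - cosang e u * cosang e v) * (enorm u * enorm v).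
Proof.
move=> e0 u0 v0; rewrite /reject.
rewrite dotpDl !dotpDr !dotpNl !dotpNr !dotpZl !dotpZr.
have -> : dotp u e = cosang e u * (enorm e * enorm u) by rewrite -dotp_cosang dotpC.
rewrite -sqr_enorm (dotp_cosang e u) (dotp_cosang e v) (dotp_cosang u v).
by field; rewrite gt_eqF// enorm_gt0.
Qed.

Lemma cosang_id u : u != 0 -> cosang u u = 1.
Proof.
by move=> u0; rewrite /cosang -sqr_enorm -expr2 divff// expf_neq0// gt_eqF// enorm_gt0.
Qed.

(** This is the spherical law of cosines at the vertex [x]: the component of an edge orthogonal to
    [y - x] has the length of that edge times a sine, and the edge lengths cancel. *)
Lemma dihedralE x y z w : y - x != 0 -> z - x != 0 -> w - x != 0 ->
  dihedral x y z w =
  sphangle (cosang (y - x) (z - x)) (cosang (y - x) (w - x)) (cosang (z - x) (w - x)).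
Proof.
rewrite /dihedral; move: (y - x) (z - x) (w - x) => e u v e0 u0 v0.
have enorm_reject f : f != 0 ->
    enorm (reject e f) = Num.sqrt (1 - cosang e f ^+ 2) * enorm f.
  move=> f0; rewrite {1}/enorm dotp_reject// cosang_id// -!expr2.
  by rewrite sqrtrM ?subr_ge0 ?cosang_sqr_le1// sqrtr_sqr ger0_norm// enorm_ge0.
rewrite /vangle /sphangle dotp_reject// !enorm_reject//; congr (acos _).
rewrite [X in _ / X]mulrACA -mulf_div divff ?mulr1//.
by rewrite mulf_neq0// gt_eqF// enorm_gt0.
Qed.

(** [reject] projects along the line of the edge, so neither reversing its direction nor moving the
    base point along it matters. *)
Lemma dihedral_swap x y z w : dihedral y x z w = dihedral x y z w.
Proof.
have rejN (e f : 'rV[R]_3) : e != 0 -> reject (- e) (f - e) = reject e f.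
  rewrite -dotp_eq0 => e0; rewrite /reject dotpDr !dotpNl !dotpNr !opprK.
  rewrite mulrDl mulNr divff// scalerN opprK scalerDl scale1r scaleNr.
  by rewrite addrACA addNr addr0.
have rej t : reject (x - y) (t - y) = reject (y - x) (t - x).
  have [->//|xy] := eqVneq x y.
  rewrite -opprB (_ : t - y = (t - x) - (y - x)); last by rewrite opprB addrA subrK.
  rewrite rejN//.
  by rewrite subr_eq0 eq_sym.
by rewrite /dihedral !rej.
Qed.

End VectorAlgebra.

(** * Tetrahedra with prescribed edge lengths *)

Section Pyramid.
Context {R : realType} {n : nat}.
Variable p : 'I_n -> 'rV[R]_3.
Implicit Types (i j k : 'I_n) (r : 'rV[R]_n) (o a b c : 'rV[R]_3).

Definition scos r i j : R := lawcos (r 0 i) (ell p i j) (r 0 j).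

Definition fcos i j k : R := lawcos (ell p i j) (ell p i k) (ell p j k).

(* Gram determinant of p_j - p_i, p_k - p_i and the apex seen from p_i, in terms
   of the edge lengths. *)
Definition apex_gram r i j k : R :=
  gram3 (ell p i j ^+ 2) (ell p i k ^+ 2) (r 0 i ^+ 2)
    ((ell p i j ^+ 2 + ell p i k ^+ 2 - ell p j k ^+ 2) / 2)
    ((r 0 i ^+ 2 + ell p i j ^+ 2 - r 0 j ^+ 2) / 2)
    ((r 0 i ^+ 2 + ell p i k ^+ 2 - r 0 k ^+ 2) / 2).

(** Over a nondegenerate face these strict inequalities characterize the existence of the
    tetrahedron; being open conditions, they make the domain open. *)
Definition realizable r i j k : Prop :=
  [/\ 0 < r 0 i, 0 < r 0 j, 0 < r 0 k & 0 < apex_gram r i j k].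

Lemma ellC i j : ell p i j = ell p j i.
Proof. exact: enorm_distC. Qed.

(** Moving the base point from the apex to [a] only changes the sign of the triple product. *)
Lemma nondegenerateP o a b c :
  Defs.nondegenerate o a b c <-> det3 (o - a) (b - a) (c - a) != 0.
Proof.
rewrite /Defs.nondegenerate rank_col_mx3.
rewrite (_ : det3 (o - a) (b - a) (c - a) = - det3 (a - o) (b - o) (c - o)) ?oppr_eq0//.
by rewrite /det3 !dotpE !crosspE !mxE; ring.
Qed.

Lemma dotp_enorm (u v : 'rV[R]_3) :
  dotp u v = (enorm u ^+ 2 + enorm v ^+ 2 - enorm (u - v) ^+ 2) / 2.
Proof.
by rewrite !sqr_enorm dotpDl !dotpDr !dotpNl !dotpNr (dotpC v u); field.
Qed.

Section PyramidCosines.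
Variables (r : 'rV[R]_n) (i j k : 'I_n) (o a b c : 'rV[R]_3).
Hypothesis Hp : pyramid p r i j k o a b c.

Lemma pyramid_det3 : det3 (o - a) (b - a) (c - a) != 0.
Proof. by case: Hp => /nondegenerateP. Qed.

Lemma pyramid_cosang :
  [/\ cosang (o - a) (b - a) = scos r i j, cosang (o - a) (c - a) = scos r i k
    & cosang (b - a) (c - a) = fcos i j k].
Proof.
case: Hp => _ [ra rb rc] [ab bc ac]; rewrite !cosang_lawcos /scos /fcos.
rewrite !opprB !addrA !subrK.
by rewrite -!(enorm_distC a) (enorm_distC o b) (enorm_distC o c) ra rb rc ab bc ac.
Qed.

(** The edge is read from its end [a] instead of the apex, so that the side opposite to the angle is
    the face angle, which does not depend on [r]. *)
Lemma pyramid_lateral :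
  dihedral o a b c = sphangle (scos r i j) (scos r i k) (fcos i j k).
Proof.
have [e0 b0 c0] := det3_neq0 pyramid_det3; have [c1 c2 c3] := pyramid_cosang.
by rewrite -dihedral_swap dihedralE// c1 c2 c3.
Qed.

Lemma pyramid_base :
  dihedral a b o c = sphangle (scos r i j) (fcos i j k) (scos r i k).
Proof.
have [e0 b0 c0] := det3_neq0 pyramid_det3; have [c1 c2 c3] := pyramid_cosang.
by rewrite dihedralE// [cosang (b - a) (o - a)]cosangC c1 c2 c3.
Qed.

Lemma pyramid_realizable : realizable r i j k.
Proof.
have nz := pyramid_det3; have [e0 b0 c0] := det3_neq0 nz.
have nz1 : det3 (a - o) (b - o) (c - o) != 0.
  by case: Hp => /rank_col_mx3.
have [a1 b1 c1] := det3_neq0 nz1.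
case: Hp => _ [ra rb rc] [ab bc ac]; split.
- by rewrite -ra enorm_gt0.
- by rewrite -rb enorm_gt0.
- by rewrite -rc enorm_gt0.
suff -> : apex_gram r i j k = det3 (b - a) (c - a) (o - a) ^+ 2.
  rewrite exprn_even_gt0//= (_ : det3 _ _ _ = det3 (o - a) (b - a) (c - a))//.
  by rewrite /det3 !dotpE !crosspE; ring.
rewrite sqr_det3 /apex_gram -ra -rb -rc -ab -bc -ac.
rewrite -!sqr_enorm (dotp_enorm (b - a) (c - a)) (dotp_enorm (c - a) (o - a)).
rewrite (dotp_enorm (b - a) (o - a)) !opprB !addrA !subrK.
rewrite (enorm_distC b a) (enorm_distC c a) (enorm_distC o a).
by rewrite ![enorm _ ^+ 2 + enorm (a - o) ^+ 2]addrC.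
Qed.

End PyramidCosines.

Lemma realizable_pyramid r i j k : crossp (p j - p i) (p k - p i) != 0 ->
  realizable r i j k -> exists o a b c, pyramid p r i j k o a b c.
Proof.
set u := p j - p i; set v := p k - p i; set w := crossp u v => w0 [ri rj rk].
rewrite /apex_gram.
have -> : ell p i j ^+ 2 = dotp u u by rewrite ellC sqr_enorm.
have -> : ell p i k ^+ 2 = dotp v v by rewrite ellC sqr_enorm.
have -> : (dotp u u + dotp v v - ell p j k ^+ 2) / 2 = dotp u v.
  rewrite (dotp_enorm u v) -!sqr_enorm; congr ((_ - _ ^+ 2) / 2); congr enorm.
  by rewrite opprB addrA subrK.
set P := (_ + dotp u u - _) / 2; set Q := (_ + dotp v v - _) / 2.
have N0 : 0 < dotp w w by rewrite dotp_gt0.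
have NE : dotp w w = dotp u u * dotp v v - dotp u v ^+ 2 by exact: lagrange.
set A := dotp u u in P NE *; set B := dotp v v in Q NE *; set C := dotp u v in NE *.
set N := dotp w w in N0 NE *; set G := gram3 _ _ _ _ _ _ => G0.
(* Cramer's rule gives the component of the apex in the plane of the face from its prescribed
   products [P], [Q] with [u], [v]. The coefficient [ga] makes the squared height equal to [G / N],
   a quotient of Gram determinants. *)
pose al := (P * B - Q * C) / N; pose be := (Q * A - P * C) / N.
pose ga := Num.sqrt G / N.
pose e := al *: u + be *: v + ga *: w.
have wu : dotp w u = 0 by exact: crossp_dotl.
have wv : dotp w v = 0 by exact: crossp_dotr.
have N_neq0 : N != 0 by rewrite gt_eqF.
have M_neq0 : A * B - C ^+ 2 != 0 by rewrite -NE.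
have ue : dotp u e = P.
  rewrite /e !dotpDr !dotpZr [dotp u w]dotpC wu -/A -/C /al /be NE.
  by field.
have ve : dotp v e = Q.
  rewrite /e !dotpDr !dotpZr [dotp v w]dotpC wv [dotp v u]dotpC -/B -/C /al /be NE.
  by field.
have we : dotp w e = ga * N by rewrite /e !dotpDr !dotpZr wu wv -/N; ring.
have ee : dotp e e = r 0 i ^+ 2.
  rewrite {1}/e !dotpDl !dotpZl ue ve we.
  have -> : ga * (ga * N) = G / N.
    by rewrite -[in RHS](sqr_sqrtr (ltW G0)) /ga; field.
  by rewrite /G /gram3 /al /be NE; field.
exists (p i + e), (p i), (p j), (p k).
have jE : p j = p i + u by rewrite addrC subrK.
have kE : p k = p i + v by rewrite addrC subrK.
clearbody e u v; split=> //.
  apply/nondegenerateP; rewrite jE kE ![p i + _]addrC !addrK.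
  have -> : det3 e u v = det3 u v e by rewrite /det3 !dotpE !crosspE; ring.
  by rewrite /det3 -/w we mulf_neq0// gt_eqF// divr_gt0// sqrtr_gt0.
rewrite jE kE !opprD !addrA subrr sub0r ![p i + _]addrC !addrK; split.
- by rewrite enormN; apply: enorm_eq (ltW ri) _.
- apply: enorm_eq (ltW rj) _.
  by rewrite dotpDl !dotpDr !dotpNr !dotpNl (dotpC e u) ue ee -/A /P; field.
- apply: enorm_eq (ltW rk) _.
  by rewrite dotpDl !dotpDr !dotpNr !dotpNl (dotpC e v) ve ee -/B /Q; field.
Qed.

(** Whichever realization [get] picks, its angle is given by the same expression in the edge
    lengths. *)
Lemma lateral_angleE r i j k : (exists o a b c, pyramid p r i j k o a b c) ->
  lateral_angle p i j k r = sphangle (scos r i j) (scos r i k) (fcos i j k).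
Proof.
move=> [ o [a [b [c pyr]]]]; rewrite /lateral_angle.
have : exists t, [set t | exists o a b c,
  pyramid p r i j k o a b c /\ t = dihedral o a b c] t.
  by exists (dihedral o a b c), o, a, b, c.
by move=> /getPex [ o' [a' [b' [c' [/pyramid_lateral <- ->]]]]].
Qed.

Lemma base_angleE r i j k : (exists o a b c, pyramid p r i j k o a b c) ->
  base_angle p i j k r = sphangle (scos r i j) (fcos i j k) (scos r i k).
Proof.
move=> [ o [a [b [c pyr]]]]; rewrite /base_angle.
have : exists t, [set t | exists o a b c,
  pyramid p r i j k o a b c /\ t = dihedral a b o c] t.
  by exists (dihedral a b o c), o, a, b, c.
by move=> /getPex [ o' [a' [b' [c' [/pyramid_base <- ->]]]]].
Qed.

Lemma pyramidC r i j k o a b c :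
  pyramid p r i j k o a b c -> pyramid p r j i k o b a c.
Proof.
case=> /rank_col_mx3 nz [ra rb rc] [ab bc ac]; split.
- by apply/rank_col_mx3; rewrite det3C12 oppr_eq0.
- by split.
- by split=> //; rewrite enorm_distC ellC.
Qed.

(** The two sets from which [get] chooses coincide, so the equality holds for every [r], including
    those without a tetrahedron. *)
Lemma base_angleC i j k : base_angle p i j k = base_angle p j i k.
Proof.
apply/funext => r; rewrite /base_angle; congr get; apply/seteqP.
by split=> t [ o [a [b [c [pyr ->]]]]]; exists o, b, a, c;
  rewrite dihedral_swap; split=> //; exact: pyramidC.
Qed.

(** A tetrahedron over a face containing the edge supplies the triangle that [rho] asks for, and
    Cauchy-Schwarz puts the cosine in the range where [acos] inverts [cos]. *)
Lemma s_scos r i j k : (exists o a b c, pyramid p r i j k o a b c) ->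
  s p i j r = scos r i j.
Proof.
move=> [ o [a [b [c pyr]]]].
have [_ [ra rb _] [ab _ _]] := pyr.
rewrite /s /rho.
have : exists t, [set t | exists o a b : 'rV[R]_3,
    [/\ enorm (a - o) = r 0 i, enorm (b - o) = r 0 j,
        enorm (a - b) = ell p i j & t = vangle (o - a) (b - a)]] t.
  by exists (vangle (o - a) (b - a)), o, a, b.
move=> /getPex [ o' [a' [b' [ra' rb' ab' ->]]]].
rewrite /vangle acosK -/(cosang _ _).
  rewrite cosang_lawcos opprB addrA subrK (enorm_distC o') (enorm_distC b').
  by rewrite (enorm_distC o') ra' rb' ab'.
by rewrite in_itv /= -ler_norml -(@expr_le1 _ 2)// real_normK ?num_real// cosang_sqr_le1.
Qed.

End Pyramid.

(** * Faces of a triangular polyhedron *)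

Section Faces.
Context {R : realType} {n : nat}.
Variable p : 'I_n -> 'rV[R]_3.
Implicit Types (i j k m : 'I_n) (u v x : 'rV[R]_3).

Lemma polytope_vertex i : polytope p (p i).
Proof.
exists (fun j => (j == i)%:R).
  split=> [j|]; first exact: ler0n.
  by rewrite (bigD1 i)//= eqxx big1 ?addr0// => j /negbTE ->.
by rewrite (bigD1 i)//= eqxx scale1r big1 ?addr0// => j /negbTE ->; rewrite scale0r.
Qed.

Lemma polytope_dotp_le u (c : R) : (forall i, dotp u (p i) <= c) ->
  forall x, polytope p x -> dotp u x <= c.
Proof.
move=> uc x [w [w0 w1] ->]; rewrite dotp_sumr -[c]mul1r -w1 mulr_suml.
by apply: ler_sum => i _; exact: ler_wpM2l.
Qed.

Hypothesis P0 : interior (polytope p) 0.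

(** As 0 is interior, the polytope contains a small positive multiple of [u], whose product with [u]
    is positive. *)
Lemma support_gt0 u (c : R) : u != 0 ->
  (forall x, polytope p x -> dotp u x <= c) -> 0 < c.
Proof.
move=> u0 uc; have /nbhs_norm0P[e /= e0 ball_p] := P0.
have u_gt0 : 0 < `|u| by rewrite normr_gt0.
pose t := e / 2 / `|u|.
have t0 : 0 < t by rewrite !divr_gt0.
have /uc : polytope p (t *: u).
  by apply: ball_p => /=; rewrite normrZ gtr0_norm// divfK ?gt_eqF// ltr_pdivrMr// ltr_pMr// ltr1n.
by apply: lt_le_trans; rewrite dotpZr mulr_gt0// dotp_gt0.
Qed.

(** Otherwise the polytope would have a supporting plane through 0. *)
Lemma exists_dotp_gt0 u : u != 0 -> exists i, 0 < dotp u (p i).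
Proof.
move=> u0; apply: contrapT => /forallNP h.
suff : (0 : R) < 0 by rewrite ltxx.
by apply: support_gt0 u0 _; apply: polytope_dotp_le => i; rewrite leNgt; apply/negP.
Qed.

Lemma triangle_swap12 i j k : triangle p i j k = triangle p j i k.
Proof. by rewrite /triangle [([set i; j])%SET]finset.setUC. Qed.

Lemma triangle_swap23 i j k : triangle p i j k = triangle p i k j.
Proof. by rewrite /triangle finset.setUAC. Qed.

Lemma edgeC i j : edge p i j = edge p j i.
Proof. by rewrite /edge eq_sym finset.setUC. Qed.

Hypothesis Ptri : triangular_polyhedron p.

Lemma triangle_support i j k : triangle p i j k -> exists u (c : R),
  [/\ 0 < c, u != 0, forall m, dotp u (p m) <= c
    & forall m, (dotp u (p m) == c) = (m \in [set i; j; k]%SET)].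
Proof.
move=> /asboolP [[u [c [u0 _ uc FE]]] _]; exists u, c; split=> //.
- exact: support_gt0 u0 uc.
- by move=> m; apply: uc; exact: polytope_vertex.
- by move=> m; rewrite FE inE.
Qed.

(** The plane of a facet misses the origin, so three noncollinear points in it are linearly
    independent as vectors. *)
Lemma triangle_det3 i j k : triangle p i j k -> det3 (p i) (p j) (p k) != 0.
Proof.
move=> tri; have [u [c [c0 u0 uc uF]]] := triangle_support tri.
move/asboolP: tri => [_ [i' [j' [k' [iF jF kF /rank_col_mx2 w0]]]]].
have [/eqP ui /eqP uj /eqP uk] : [/\ dotp u (p i') == c, dotp u (p j') == c & dotp u (p k') == c].
  by rewrite !uF.
have nz : det3 (p i') (p j') (p k') != 0.
  have w_gt0 : 0 < dotp (crossp (p j' - p i') (p k' - p i')) (crossp (p j' - p i') (p k' - p i')).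
    by rewrite dotp_gt0.
  have : det3 (p j' - p i') (p k' - p i') (p i') * det3 (p j' - p i') (p k' - p i') u != 0.
    (* A product of two triple products is a determinant of dot products; it collapses because [u]
       is orthogonal to both sides of the triangle. *)
    have -> : det3 (p j' - p i') (p k' - p i') (p i') * det3 (p j' - p i') (p k' - p i') u =
        c * dotp (crossp (p j' - p i') (p k' - p i')) (crossp (p j' - p i') (p k' - p i')).
      set x := p j' - p i'; set y := p k' - p i'.
      have ux : dotp u x = 0 by rewrite /x dotpDr dotpNr ui uj subrr.
      have uy : dotp u y = 0 by rewrite /y dotpDr dotpNr ui uk subrr.
      rewrite -ui lagrange; clearbody x y; move: (p i') => z.
      transitivity ((dotp x x * dotp y y - dotp x y ^+ 2) * dotp u z +
        dotp u x * (dotp x y * dotp y z - dotp y y * dotp x z) +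
        dotp u y * (dotp x y * dotp x z - dotp x x * dotp y z)).
        by rewrite /det3 !dotpE !crosspE; ring.
      by rewrite ux uy; ring.
    by rewrite mulf_neq0// gt_eqF.
  rewrite mulf_eq0 negb_or => /andP[+ _].
  by rewrite /det3 !dotpE !crosspE !mxE; congr (_ != 0); ring.
have det3E (x y z : 'rV[R]_3) : det3 x y z =
  (x 0 1 * y 0 2 - x 0 2 * y 0 1) * z 0 0 + (x 0 2 * y 0 0 - x 0 0 * y 0 2) * z 0 1 +
  (x 0 0 * y 0 1 - x 0 1 * y 0 0) * z 0 2 by rewrite /det3 dotpE !crosspE.
(* The primed indices range over [i], [j], [k]: even permutations keep the determinant, odd ones
   change its sign, and repetitions make it zero. *)
apply: contraNneq nz => h; move: iF jF kF; rewrite !inE.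
by move=> /orP[/orP[]|] /eqP -> /orP[/orP[]|] /eqP -> /orP[/orP[]|] /eqP ->;
  first [rewrite -h; apply/eqP; rewrite !det3E; ring
        |rewrite -oppr_eq0 -h; apply/eqP; rewrite !det3E; ring
        |apply/eqP; rewrite !det3E; ring].
Qed.

Lemma triangle_neq i j k : triangle p i j k -> i != j.
Proof.
move=> /triangle_det3; apply: contraNneq => ->.
by rewrite /det3 !dotpE !crosspE; apply/eqP; ring.
Qed.

(* Tilting the supporting plane of a triangle slightly about one of its sides
   leaves only that side in contact with the polytope. *)
Lemma triangle_edge i j k : triangle p i j k -> edge p i j.
Proof.
move=> tri; have [u [c [c0 u0 uc uF]]] := triangle_support tri.
have nz := triangle_det3 tri.
set D := det3 _ _ _ in nz.
(* The tilt direction is normal to the plane through 0, [p i] and [p j], with the sign that pushes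
   [p k] strictly below the supporting plane. *)
pose v := - D *: crossp (p i) (p j).
have vi : dotp v (p i) = 0 by rewrite dotpZl crossp_dotl mulr0.
have vj : dotp v (p j) = 0 by rewrite dotpZl crossp_dotr mulr0.
have vk : dotp v (p k) < 0.
  by rewrite dotpZl -/(det3 _ _ _) -/D mulNr oppr_lt0 -expr2 exprn_even_gt0.
have [e e0 he] : exists2 e : R, 0 < e &
    forall m, m \notin [set i; j; k]%SET -> dotp u (p m) + e * dotp v (p m) < c.
  near (0 : R)^'+ => e; exists e => // m.
  move: m; near: e; apply: filter_forall => m.
  have [mF|mF] := boolP (m \in _); first exact: nearW.
  have um : dotp u (p m) < c by rewrite lt_neqAle uc uF mF.
  (* Each of the finitely many other vertices lies strictly below the plane and tolerates tilts up
     to this bound; the summand 1 keeps the denominator positive. *)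
  have d0 : 0 < (c - dotp u (p m)) / (1 + `|dotp v (p m)|).
    by rewrite divr_gt0 ?subr_gt0// ltr_wpDr.
  near=> e => _; rewrite addrC -ltrBrDr.
  apply: (@le_lt_trans _ _ (e * (1 + `|dotp v (p m)|))).
    rewrite ler_pM2l//; apply: le_trans (ler_norm _) _.
    by rewrite lerDr ler01.
  by rewrite -ltr_pdivlMr ?ltr_wpDr//; near: e; exact: nbhs_right_lt.
rewrite /edge (triangle_neq tri); apply/asboolP.
exists (u + e *: v), c.
have val m : dotp (u + e *: v) (p m) = dotp u (p m) + e * dotp v (p m).
  by rewrite dotpDl dotpZl.
have [/eqP ui /eqP uj /eqP uk] : [/\ dotp u (p i) == c, dotp u (p j) == c & dotp u (p k) == c].
  by rewrite !uF !inE !eqxx ?orbT.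
have lec m : dotp (u + e *: v) (p m) < c \/
    dotp (u + e *: v) (p m) = c /\ m \in [set i; j]%SET.
  rewrite val; have [|/he] := boolP (m \in [set i; j; k]%SET); last by left.
  rewrite !inE => /orP[/orP[]|] /eqP ->.
  - by right; rewrite vi mulr0 addr0 eqxx.
  - by right; rewrite vj mulr0 addr0 eqxx orbT.
  - by left; rewrite uk gtrDl pmulr_rlt0.
split.
- apply: contraTneq c0 => z0; rewrite -leNgt.
  by have := val i; rewrite ui vi mulr0 addr0 z0 dotpC dotp0 => <-.
- by apply/finset.set0Pn; exists i; rewrite !inE eqxx.
- by apply: polytope_dotp_le => m; case: (lec m) => [/ltW//|[->]].
- apply/setP => m; rewrite [RHS]inE; case: (lec m) => [lt|[-> ->]]; last by rewrite eqxx.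
  rewrite (lt_eqF lt) !inE; apply: contraTF lt => /orP[]/eqP ->; rewrite val.
  + by rewrite ui vi mulr0 addr0 ltxx.
  + by rewrite uj vj mulr0 addr0 ltxx.
Unshelve. all: by end_near. Qed.

(* Rotate a supporting plane of the edge about the edge until it hits a further
   vertex. *)
Lemma edge_triangle i j : edge p i j -> exists k, triangle p i j k.
Proof.
move=> /andP[ij /asboolP[u [c [u0 _ uc FE]]]].
have c0 := support_gt0 u0 uc.
have ui : dotp u (p i) = c.
  by apply/eqP; have := set21 i j; rewrite FE inE.
have uj : dotp u (p j) = c.
  by apply/eqP; have := set22 i j; rewrite FE inE.
have {}uc m : dotp u (p m) <= c by apply: uc; exact: polytope_vertex.
(* Adding multiples of [v] to [u] rotates the plane while keeping the value [c] at [p i] and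
   [p j]. *)
pose v := crossp (p i) (p j).
have vi : dotp v (p i) = 0 by exact: crossp_dotl.
have vj : dotp v (p j) = 0 by exact: crossp_dotr.
(* If [v] were 0, [p i] and [p j] would be parallel; having the same height [c], they would
   coincide, against the singleton faces. *)
have v0 : v != 0.
  apply/negP => /eqP w0; have := double_crossp (p i) (p j); rewrite -/v w0.
  have -> : crossp (p j) 0 = 0.
    by apply: row3P; rewrite !crosspE !mxE; ring.
  move=> /subr0_eq e.
  have := congr1 (dotp u) e; rewrite !dotpZr ui uj => /(mulIf (lt0r_neq0 c0)) e'.
  have pj0 : dotp (p j) (p j) != 0.
    by rewrite dotp_eq0; apply: contraTneq c0 => pj0; rewrite -uj pj0 dotp0 ltxx.
  move: e; rewrite -e' => /(scalerI pj0) pij.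
  have [a [b [_ _ _ Fi]]] := Ptri.1 i.
  have : j \in [set i]%SET by rewrite Fi inE -pij; have := set11 i; rewrite Fi inE.
  by rewrite !inE eq_sym (negbTE ij).
have [m0 vm0] := exists_dotp_gt0 v0.
(* The parameter at which the rotating plane reaches [p m]. Only vertices with positive product with
   [v] can be hit, and the smallest parameter gives the first one. *)
pose q m := (c - dotp u (p m)) / dotp v (p m).
case: (@arg_minP _ _ _ m0 (fun m => 0 < dotp v (p m)) q vm0) => k vk kmin.
have t0 : 0 <= q k by rewrite divr_ge0 ?subr_ge0// ltW.
have val m : dotp (u + q k *: v) (p m) = dotp u (p m) + q k * dotp v (p m).
  by rewrite dotpDl dotpZl.
exists k; apply/asboolP.
pose F := [set m | dotp (u + q k *: v) (p m) == c]%SET.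
have iF : i \in F by rewrite inE val ui vi mulr0 addr0.
have jF : j \in F by rewrite inE val uj vj mulr0 addr0.
have qk : q k * dotp v (p k) = c - dotp u (p k) by rewrite divfK// gt_eqF.
have kF : k \in F by rewrite inE val qk addrC subrK.
have facetF : facet p F.
  split; last first.
    exists i, j, k; split=> //; apply/rank_col_mx2.
    apply: contraTneq vk => w0.
    rewrite (_ : dotp v (p k) = dotp (crossp (p j - p i) (p k - p i)) (p i)).
      by rewrite w0 dotpC dotp0 ltxx.
    by rewrite /v !dotpE !crosspE !mxE; ring.
  exists (u + q k *: v), c; split=> //.
  - apply: contraTneq c0 => z0; rewrite -leNgt.
    by have := val i; rewrite ui vi mulr0 addr0 z0 dotpC dotp0 => <-.
  - by apply/finset.set0Pn; exists i.
  - apply: polytope_dotp_le => m; rewrite val.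
    have [vm|vm] := ltP 0 (dotp v (p m)).
      by rewrite addrC -lerBrDr -ler_pdivlMr//; exact: kmin.
    by rewrite -[c]addr0 lerD// mulr_ge0_le0.
suff -> : [set i; j; k]%SET = F by [].
(* The facet contains the three distinct indices and has exactly three elements. *)
apply/eqP; rewrite eqEcard (Ptri.2 _ facetF); apply/andP; split.
  apply/fintype.subsetP => m; rewrite !inE => /orP[/orP[]|] /eqP ->;
    by move: iF jF kF; rewrite !inE.
rewrite finset.setUC cardsU1 cards2 ij !inE negb_or.
by rewrite !(contraTneq _ vk)// => ->; rewrite ?vi ?vj ltxx.
Qed.

End Faces.

(** * The spherical law of cosines and its differential *)

Section Calculus.
Context {R : realType}.

(** Both derivatives are limits of the same difference quotient. *)
Lemma is_derive_lineP n (f : 'rV[R]_n -> R) (r v : 'rV[R]_n) (t df : R) :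
  is_derive t 1 (fun t => f (r + t *: v)) df <-> is_derive (r + t *: v) v f df.
Proof.
have E : (fun h : R => h^-1 *: (((fun t => f (r + t *: v)) \o shift t) (h *: 1) - f (r + t *: v)))
       = (fun h : R => h^-1 *: ((f \o shift (r + t *: v)) (h *: v) - f (r + t *: v))).
  apply/funext => h; congr (_ *: (f _ - _)) => /=.
  by rewrite [h *: 1]mulr1 scalerDl addrCA.
by split=> -[dv dE]; split; move: dv dE; rewrite /derivable /derive E.
Qed.

Lemma is_derive_bigsum (V : normedModType R) I (s : seq I) (P : pred I)
    (h : I -> V -> R) (dh : I -> R) (x v : V) :
  (forall i, P i -> is_derive x v (h i) (dh i)) ->
  is_derive x v (fun y => \sum_(i <- s | P i) h i y) (\sum_(i <- s | P i) dh i).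
Proof.
move=> H; elim: s => [|i s IH].
  by rewrite big_nil; under eq_fun do rewrite big_nil; exact: is_derive_cst.
rewrite big_cons; under eq_fun do rewrite big_cons.
by case: ifPn => // Pi; apply: is_deriveD IH; exact: H.
Qed.

Lemma sqr_lt1_itv (q : R) : q ^+ 2 < 1 -> -1 < q < 1.
Proof. by move=> h; rewrite -ltr_norml -(@expr_lt1 _ 2)// real_normK ?num_real. Qed.

(** The sine of the angle is the square root of [gramc] divided by the sines of the two adjacent
    sides, so the derivative of [acos] brings that root into the denominator. *)
Lemma is_derive_sphangle (x y z : R -> R) (t dx dy dz : R) :
  is_derive t 1 x dx -> is_derive t 1 y dy -> is_derive t 1 z dz ->
  x t ^+ 2 < 1 -> y t ^+ 2 < 1 -> 0 < gramc (x t) (y t) (z t) ->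
  is_derive t 1 (fun t => sphangle (x t) (y t) (z t))
    ((dx * (y t - z t * x t) / (1 - x t ^+ 2) + dy * (x t - z t * y t) / (1 - y t ^+ 2) - dz)
     / Num.sqrt (gramc (x t) (y t) (z t))).
Proof.
move=> Dx Dy Dz x1 y1 D0.
have dsqrt (f : R -> R) df : is_derive t 1 f df -> f t ^+ 2 < 1 ->
    is_derive t 1 (fun s => Num.sqrt (1 - f s ^+ 2)) (- (f t * df / Num.sqrt (1 - f t ^+ 2))).
  move=> Df f1; have a0 : 0 < 1 - f t ^+ 2 by rewrite subr_gt0.
  have da : is_derive t 1 (cst 1 - f * f) (0 - (f t *: df + f t *: df)).
    by apply: is_deriveB.
  have := @is_derive1_comp _ Num.sqrt (cst 1 - f * f) t _ _ (is_derive1_sqrt a0) da.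
  move/is_derive_eq; apply.
  have : Num.sqrt (1 - f t ^+ 2) != 0 by rewrite gt_eqF ?sqrtr_gt0.
  by rewrite -[_ *: _]/(f t * df); set q := Num.sqrt _ => q0; field.
have := dsqrt _ _ Dy y1; have := dsqrt _ _ Dx x1 => {dsqrt}.
set sa := Num.sqrt (1 - x t ^+ 2); set sb := Num.sqrt (1 - y t ^+ 2) => Da Db.
set sd := Num.sqrt _.
have sa0 : sa != 0 by rewrite gt_eqF// sqrtr_gt0 subr_gt0.
have sb0 : sb != 0 by rewrite gt_eqF// sqrtr_gt0 subr_gt0.
have sd0 : sd != 0 by rewrite gt_eqF// sqrtr_gt0.
have sa2 : sa ^+ 2 = 1 - x t ^+ 2 by rewrite sqr_sqrtr// subr_ge0 ltW.
have sb2 : sb ^+ 2 = 1 - y t ^+ 2 by rewrite sqr_sqrtr// subr_ge0 ltW.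
have sd2 : sd ^+ 2 = gramc (x t) (y t) (z t) by rewrite sqr_sqrtr// ltW.
pose q := (z t - x t * y t) / (sa * sb).
have q2 : 1 - q ^+ 2 = (sd / (sa * sb)) ^+ 2.
  rewrite /q !expr_div_n sd2 exprMn -{1}(@divff _ (sa ^+ 2 * sb ^+ 2)); last first.
    by rewrite mulf_neq0// expf_neq0.
  by rewrite -mulrBl {1}sa2 {1}sb2 /gramc; congr (_ / _); ring.
have q1 : -1 < q < 1.
  by apply: sqr_lt1_itv; rewrite -subr_gt0 q2 exprn_even_gt0//= mulf_neq0// invr_eq0 mulf_neq0.
have sq : Num.sqrt (1 - q ^+ 2) = sd / (sa * sb).
  by rewrite q2 sqrtr_sqr ger0_norm// divr_ge0 ?mulr_ge0 ?sqrtr_ge0.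
have Dnum : is_derive t 1 (z - x * y) (dz - (x t *: dy + y t *: dx)).
  by apply: is_deriveB.
have den0 : ((fun s => Num.sqrt (1 - x s ^+ 2)) * (fun s => Num.sqrt (1 - y s ^+ 2))) t != 0.
  by rewrite mulf_neq0.
have Dq := is_deriveM Dnum (is_deriveV den0 (is_deriveM Da Db)).
have Dacos : is_derive (((z - x * y) * (fun s => (((fun s => Num.sqrt (1 - x s ^+ 2)) *
    (fun s => Num.sqrt (1 - y s ^+ 2))) s)^-1)) t) 1 (@acos R) _ := is_derive1_acos q1.
have := is_derive1_comp Dacos Dq.
move/is_derive_eq; apply.
rewrite -[LHS]/(- (Num.sqrt (1 - q ^+ 2))^-1 * ((z t - x t * y t) *
  (- (sa * sb) ^- 2 * (sa * - (y t * dy / sb) + sb * - (x t * dx / sa))) +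
  (sa * sb)^-1 * (dz - (x t * dy + y t * dx)))).
rewrite sq -sa2 -sb2; clearbody sa sb sd.
(* With the numerators in this form the identity holds for independent [sa] and [sb], as [field]
   requires. *)
have -> : y t - z t * x t = y t * sa ^+ 2 - x t * (z t - x t * y t) by rewrite sa2; ring.
have -> : x t - z t * y t = x t * sb ^+ 2 - y t * (z t - x t * y t) by rewrite sb2; ring.
by field; rewrite sa0 sb0 sd0.
Qed.

(* Differential of the cosine law of a spherical triangle with one side of
   constant length. *)
Lemma sphangle_variation (x y : R -> R) (c t dx dy : R) :
  is_derive t 1 x dx -> is_derive t 1 y dy ->
  x t ^+ 2 < 1 -> y t ^+ 2 < 1 -> c ^+ 2 < 1 -> 0 < gramc (x t) (y t) c ->
  exists da db1 db2 : R,
    [/\ is_derive t 1 (fun t => sphangle (x t) (y t) c) da,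
        is_derive t 1 (fun t => sphangle (x t) c (y t)) db1,
        is_derive t 1 (fun t => sphangle (y t) c (x t)) db2
      & da + x t * db1 + y t * db2 = 0].
Proof.
move=> Dx Dy x1 y1 c1 D0.
have Dc : is_derive t 1 (fun=> c) 0 by exact: is_derive_cst.
have g1 : gramc (x t) c (y t) = gramc (x t) (y t) c by rewrite /gramc; ring.
have g2 : gramc (y t) c (x t) = gramc (x t) (y t) c by rewrite /gramc; ring.
do 3 eexists; split.
- exact: is_derive_sphangle.
- by apply: is_derive_sphangle => //; rewrite g1.
- by apply: is_derive_sphangle => //; rewrite g2.
rewrite g1 g2.
have s0 : Num.sqrt (gramc (x t) (y t) c) != 0 by rewrite gt_eqF// sqrtr_gt0.
have x0 : 1 - x t ^+ 2 != 0 by rewrite gt_eqF// subr_gt0.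
have y0 : 1 - y t ^+ 2 != 0 by rewrite gt_eqF// subr_gt0.
have c0 : 1 - c ^+ 2 != 0 by rewrite gt_eqF// subr_gt0.
by field; rewrite s0 x0 y0 c0.
Qed.

(** The square of index pairs is split along its diagonal. This serves both for the faces around a
    vertex and for the edges. *)
Lemma sum_unordered_pairs n (F : 'I_n -> 'I_n -> R) : (forall i, F i i = 0) ->
  \sum_(i < n) \sum_(j < n | (i < j)%N) (F i j + F j i) = \sum_(i < n) \sum_(j < n) F i j.
Proof.
move=> F0; under eq_bigr do rewrite big_split /=.
rewrite big_split/= [X in _ + X](exchange_big_dep xpredT)//=.
rewrite -big_split/=; apply: eq_bigr => i _.
rewrite [RHS](bigID (fun j : 'I_n => (i < j)%N))/=; congr (_ + _).
rewrite [RHS](bigD1 i) ?ltnn//= F0 add0r; apply: eq_bigl => j.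
by rewrite -leqNgt ltn_neqAle andbC.
Qed.

End Calculus.

(** * Variation of the warped polyhedron *)

Section WarpedPolyhedron.
Context {R : realType} {n : nat}.
Variable p : 'I_n -> 'rV[R]_3.
Implicit Types (i j k : 'I_n) (r v : 'rV[R]_n).
Hypothesis Ptri : triangular_polyhedron p.
Hypothesis P0 : interior (polytope p) 0.

Lemma realizable_warped r :
  warped_domain p r <-> forall i j k, triangle p i j k -> realizable p r i j k.
Proof.
split=> H i j k tri.
  by have [ o [a [b [c /pyramid_realizable]]]] := H i j k tri.
apply: realizable_pyramid (H i j k tri).
have /det3_crossp : det3 (p j - p i) (p k - p i) (p i) != 0; last by [].
have := triangle_det3 P0 tri.
by rewrite /det3 !dotpE !crosspE !mxE; congr (_ != 0); ring.
Qed.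

(** The original pyramids, with apex 0, are realizations. *)
Lemma warped_domain_r0 : warped_domain p (r0 p).
Proof.
move=> i j k tri; exists 0, (p i), (p j), (p k); split.
- by apply/rank_col_mx3; rewrite !subr0; exact: triangle_det3 tri.
- by rewrite !subr0 !mxE.
- by [].
Qed.

Lemma apex_gram_continuous r i j k :
  (fun x => apex_gram p x i j k) @ r --> apex_gram p r i j k.
Proof.
have ci m : (fun r : 'rV[R]_n => r 0 m) @ r --> r 0 m by exact: coord_continuous.
have csq (f : 'rV[R]_n -> R) : f @ r --> f r -> (fun x => f x ^+ 2) @ r --> f r ^+ 2.
  by move=> cf; exact (cvgM cf cf).
have ccst (a : R) : (fun _ : 'rV[R]_n => a) @ r --> a by exact (@cvg_cst _ a _ (nbhs r) _).
have cdot (l : R) m : (fun x : 'rV[R]_n => (x 0 i ^+ 2 + l - x 0 m ^+ 2) / 2) @ r -->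
    (r 0 i ^+ 2 + l - r 0 m ^+ 2) / 2.
  exact (cvgM (cvgB (cvgD (csq _ (ci i)) (ccst l)) (csq _ (ci m))) (ccst 2^-1)).
rewrite /apex_gram; set A := ell p i j ^+ 2; set B := ell p i k ^+ 2.
set C := (A + B - _) / 2; clearbody A B C.
have cP := cdot A j; have cQ := cdot B k; have cI := csq _ (ci i).
exact (cvgB (cvgB (cvgB (cvgD (cvgM (ccst (A * B)) cI) (cvgM (cvgM (ccst (2 * C)) cP) cQ))
  (cvgM (ccst A) (csq _ cQ))) (cvgM (ccst B) (csq _ cP))) (cvgM cI (ccst (C ^+ 2)))).
Qed.

(** By [realizable_warped] the domain is cut out by finitely many strict inequalities between
    continuous functions. *)
Lemma near_warped_domain r : warped_domain p r ->
  \forall x \near r, warped_domain p x.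
Proof.
move=> /realizable_warped rr.
suff : \forall x \near r, forall i j k, triangle p i j k -> realizable p x i j k.
  by apply: filterS => x /realizable_warped.
have FF : Filter (nbhs r) by exact: nbhs_filter.
apply: (@filter_forall _ _ _ (nbhs r)) => i; apply: (@filter_forall _ _ _ (nbhs r)) => j.
apply: (@filter_forall _ _ _ (nbhs r)) => k.
have [tri|] := boolP (triangle p i j k); last by move=> ntri; exact: nearW.
have [ri rj rk rg] := rr i j k tri.
have coord_gt m : 0 < r 0 m -> \forall x \near r, 0 < (x : 'rV[R]_n) 0 m.
  move=> rm; have cm : (fun x : 'rV[R]_n => x 0 m) @ r --> r 0 m by exact: coord_continuous.
  exact: (@cvgr_gt _ _ (nbhs r) FF _ _ cm 0 rm).
have gram_gt : \forall x \near r, 0 < apex_gram p x i j k.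
  have cg := @apex_gram_continuous r i j k.
  exact: (@cvgr_gt _ _ (nbhs r) FF _ _ cg 0 rg).
near=> x => _; split; near: x.
- exact: (coord_gt i).
- exact: (coord_gt j).
- exact: (coord_gt k).
- exact: gram_gt.
Unshelve. all: by end_near. Qed.

Lemma warped_domain_open : open (warped_domain p).
Proof. by rewrite openE => r; exact: near_warped_domain. Qed.

Lemma lambdaC i j : lambda p i j = lambda p j i.
Proof.
apply/funext => x; rewrite /lambda; congr (_ - _).
by apply: eq_big => [k|k _]; [exact: triangle_swap12|rewrite base_angleC].
Qed.

Lemma ell_gt0 i j k : triangle p i j k -> 0 < ell p i j.
Proof.
move=> tri; rewrite enorm_gt0 subr_eq0; have := triangle_det3 P0 tri.
by apply: contraNneq => ->; rewrite /det3 !dotpE !crosspE; apply/eqP; ring.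
Qed.

Lemma is_derive_coord r v i : is_derive r v (fun x : 'rV[R]_n => x 0 i) (v 0 i).
Proof.
have [+ _] := is_derive_lineP (fun x : 'rV[R]_n => x 0 i) r v 0 (v 0 i).
rewrite scale0r addr0; apply.
have D := @is_deriveD R R R (cst (r 0 i)) _ 0 1 _ _ (is_derive_cst _ _ _)
  (@is_deriveZ R R R id (v 0 i) 0 1 _ (is_derive_id _ _)).
rewrite (_ : (fun t => _) = cst (r 0 i) + v 0 i \*: id).
  by apply: is_derive_eq; rewrite add0r [_ *: _]mulr1.
by apply/funext => t; rewrite !mxE mulrC.
Qed.

Lemma derivable_scos r v i j : 0 < ell p i j -> 0 < r 0 i ->
  derivable (fun x => scos p x i j) r v.
Proof.
move=> l0 ri.
have Di := @ex_derive _ _ _ _ _ _ _ (is_derive_coord r v i).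
have Dj := @ex_derive _ _ _ _ _ _ _ (is_derive_coord r v j).
have den0 : (cst 2 * (fun x : 'rV[R]_n => x 0 i) * cst (ell p i j)) r != 0.
  by rewrite !mulf_neq0 ?gt_eqF.
have Dcst (x : R) := @derivable_cst R _ R x r v.
have Dden := derivableV den0 (derivableM (derivableM (Dcst 2) Di) (Dcst (ell p i j))).
have Dnum := derivableB (derivableD (derivableM Di Di) (Dcst (ell p i j ^+ 2)))
  (derivableM Dj Dj).
exact: derivableM Dnum Dden.
Qed.

Lemma is_derive_line0 (f : 'rV[R]_n -> R) r v (df : R) :
  is_derive (0 : R) 1 (fun t : R => f (r + t *: v)) df <-> is_derive r v f df.
Proof. by have := is_derive_lineP f r v 0 df; rewrite scale0r addr0. Qed.

(** * Derivatives of the angles and curvatures at a point of the domain *)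

Section Derivatives.
(* Otherwise matching derivatives of distinct angle functions unfolds them. *)
Local Opaque lateral_angle base_angle s.
Variables (r v : 'rV[R]_n).
Hypothesis rW : warped_domain p r.

(** This is [sphangle_variation] along the line through [r], in the spherical triangle cut out at
    [p i]. *)
Lemma triangle_derivatives i j k : triangle p i j k ->
  [/\ derivable (s p i j) r v, derivable (lateral_angle p i j k) r v,
      derivable (base_angle p i j k) r v
    & 'D_v (lateral_angle p i j k) r
      + s p i j r * 'D_v (base_angle p i j k) r
      + s p i k r * 'D_v (base_angle p i k j) r = 0].
Proof.
move=> tri; have tri' : triangle p i k j by rewrite -triangle_swap23.
have [ o [a [b [c pyr]]]] := rW tri.
have [ri rj rk _] := pyramid_realizable pyr.
have nz := pyramid_det3 pyr; have [cij cik cjk] := pyramid_cosang pyr.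
have Dij := derivable_scos (v := v) (ell_gt0 tri) ri.
have Dik := derivable_scos (v := v) (ell_gt0 tri') ri.
have /is_derive_line0 Lij := derivableP Dij.
have /is_derive_line0 Lik := derivableP Dik.
have at0 l : scos p (r + 0 *: v) i l = scos p r i l by rewrite scale0r addr0.
have nz2 : det3 (o - a) (c - a) (b - a) != 0 by rewrite det3C23 oppr_eq0.
have nz3 : det3 (b - a) (c - a) (o - a) != 0.
  by rewrite det3C23 det3C12 opprK.
have := @sphangle_variation R _ _ (fcos p i j k) 0 _ _ Lij Lik.
rewrite !at0 -cij -cik -cjk (cosang_sqr_lt1 (det3_crossp nz)).
rewrite (cosang_sqr_lt1 (det3_crossp nz2)) (cosang_sqr_lt1 (det3_crossp nz3)).
rewrite (gramc_gt0 nz) cij cik cjk => /(_ isT isT isT isT)[da [db1 [db2 []]]].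
move=> /(is_derive_line0 (fun x => sphangle (scos p x i j) (scos p x i k) (fcos p i j k))) Da.
move=> /(is_derive_line0 (fun x => sphangle (scos p x i j) (fcos p i j k) (scos p x i k))) Db1.
move=> /(is_derive_line0 (fun x => sphangle (scos p x i k) (fcos p i j k) (scos p x i j))) Db2 sum0.
(* The angle functions agree with their explicit expressions only on the domain; its openness lets
   the derivatives be transferred. *)
have near_dom := near_warped_domain rW.
have fcosC : fcos p i k j = fcos p i j k.
  by rewrite /fcos (ellC p k j) /lawcos; congr (_ / _); ring.
have {}Da : is_derive r v (lateral_angle p i j k) da.
  apply: near_eq_is_derive Da; apply: filterS near_dom => x xW.
  by rewrite lateral_angleE//; exact: xW.
have {}Db1 : is_derive r v (base_angle p i j k) db1.
  apply: near_eq_is_derive Db1; apply: filterS near_dom => x xW.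
  by rewrite base_angleE//; exact: xW.
have {}Db2 : is_derive r v (base_angle p i k j) db2.
  apply: near_eq_is_derive Db2; apply: filterS near_dom => x xW.
  by rewrite base_angleE ?fcosC//; exact: xW.
have Ds : derivable (s p i j) r v.
  apply: near_eq_derivable Dij; apply: filterS near_dom => x xW.
  by rewrite (s_scos (xW _ _ _ tri)).
have sij := s_scos (rW tri); have sik := s_scos (rW tri').
case: Da => Da eDa; case: Db1 => Db1 eDb1; case: Db2 => _ eDb2.
split; [exact: Ds|exact: Da|exact: Db1|].
by move: sum0; rewrite -eDa -eDb1 -eDb2 -sij -sik.
Qed.

Lemma is_derive_kappa i : is_derive r v (kappa p i)
  (- \sum_(j < n) \sum_(k < n | (j < k)%N && triangle p i j k) 'D_v (lateral_angle p i j k) r).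
Proof.
rewrite -[X in is_derive _ _ _ X]add0r.
apply: (@is_deriveB _ _ _ (cst (2 * pi)) (omega p i)).
apply: is_derive_bigsum => j _; apply: is_derive_bigsum => k /andP[_ tri].
by apply: derivableP; have [] := triangle_derivatives tri.
Qed.

Lemma is_derive_lambda i j : is_derive r v (lambda p i j)
  (- \sum_(k | triangle p i j k) 'D_v (base_angle p i j k) r).
Proof.
rewrite -[X in is_derive _ _ _ X]add0r.
apply: (@is_deriveB _ _ _ (cst pi) (fun x => \sum_(k | triangle p i j k) base_angle p i j k x)).
apply: is_derive_bigsum => k tri.
by apply: derivableP; have [] := triangle_derivatives tri.
Qed.

Local Opaque kappa lambda.

Lemma derive_kappa i :
  'D_v (kappa p i) r = - \sum_(j | edge p i j) s p i j r * 'D_v (lambda p i j) r.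
Proof.
rewrite (@derive_val _ _ _ _ _ _ _ (is_derive_kappa i)); congr (- _).
(* A face at [p i] contributes to two edges there, hence to two ordered pairs: [F j k] is its share
   at the edge towards [p j]. *)
pose F j k := if triangle p i j k then s p i j r * 'D_v (base_angle p i j k) r else 0.
transitivity (- \sum_j \sum_k F j k).
  rewrite -sum_unordered_pairs => [|j]; last first.
    by rewrite /F triangle_swap12 triangle_swap23; case: ifP => // /(triangle_neq P0); rewrite eqxx.
  rewrite -sumrN; apply: eq_bigr => j _; rewrite -sumrN big_mkcondr/=.
  apply: eq_bigr => k _; rewrite /F -(triangle_swap23 p i j k).
  case: ifP => tri; last by rewrite addr0 oppr0.
  have [_ _ _] := triangle_derivatives tri.
  by rewrite -addrA => /eqP; rewrite addr_eq0 => /eqP.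
rewrite -sumrN [RHS]big_mkcond/=; apply: eq_bigr => j _.
rewrite (@derive_val _ _ _ _ _ _ _ (is_derive_lambda i j)).
rewrite mulrN mulr_sumr -big_mkcond/=.
(* Indices [j] not joined to [i] contribute nothing, since every side of a face is an edge. *)
case: ifPn => // nedge; rewrite big1 ?oppr0// => k /(triangle_edge P0).
by rewrite (negbTE nedge).
Qed.

End Derivatives.

(** The two summands are the signed projections of the lateral sides onto the base of the triangle.
    A face at the edge supplies the tetrahedron behind [s_scos]. *)
Lemma ell_s r i j : warped_domain p r -> edge p i j ->
  r 0 i * s p i j r + r 0 j * s p j i r = ell p i j.
Proof.
move=> rW /(edge_triangle P0 Ptri)[k tri].
have tri' : triangle p j i k by rewrite triangle_swap12.
have [ o [a [b [c pyr]]]] := rW _ _ _ tri.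
have [ri rj _ _] := pyramid_realizable pyr.
have l0 := ell_gt0 tri.
rewrite (s_scos (rW _ _ _ tri)) (s_scos (rW _ _ _ tri')) /scos /lawcos (ellC p j i).
by field; rewrite !gt_eqF.
Qed.

Lemma sum_edges (F : 'I_n -> 'I_n -> R) :
  \sum_(i < n) \sum_(j < n | (i < j)%N && edge p i j) (F i j + F j i) =
  \sum_(i < n) \sum_(j < n | edge p i j) F i j.
Proof.
pose G i j := if edge p i j then F i j else 0.
transitivity (\sum_(i < n) \sum_(j < n | (i < j)%N) (G i j + G j i)).
  apply: eq_bigr => i _; rewrite big_mkcondr/=; apply: eq_bigr => j _.
  by rewrite /G (edgeC p j i); case: ifP; rewrite ?addr0.
rewrite sum_unordered_pairs => [|i]; last by rewrite /G /edge eqxx.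
by apply: eq_bigr => i _; rewrite [RHS]big_mkcond.
Qed.

Lemma derivable_s r v i j : warped_domain p r -> edge p i j -> derivable (s p i j) r v.
Proof.
by move=> rW /(edge_triangle P0 Ptri)[k tri]; have [] := triangle_derivatives v rW tri.
Qed.

(** The identity [ell_s] holds in a neighborhood of [r], and its right-hand side is constant. *)
Lemma derive_ell_s r v i j : warped_domain p r -> edge p i j ->
  (v 0 i * s p i j r + r 0 i * 'D_v (s p i j) r) +
  (v 0 j * s p j i r + r 0 j * 'D_v (s p j i) r) = 0.
Proof.
move=> rW eij; have eji : edge p j i by rewrite edgeC.
pose f (x : 'rV[R]_n) := x 0 i * s p i j x + x 0 j * s p j i x.
have D : is_derive r v f _ := is_deriveD
  (is_deriveM (is_derive_coord r v i) (derivableP (derivable_s (v := v) rW eij)))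
  (is_deriveM (is_derive_coord r v j) (derivableP (derivable_s (v := v) rW eji))).
have near_ell : \forall x \near r, f x = cst (ell p i j) x.
  by apply: filterS (near_warped_domain rW) => x xW; exact: ell_s.
have D0 : is_derive r v (cst (ell p i j)) (0 : R) by exact: is_derive_cst.
have D1 := near_eq_is_derive near_ell D.
have := @derive_val _ _ _ _ _ _ _ D1; rewrite (@derive_val _ _ _ _ _ _ _ D0) => e.
rewrite [RHS]e -![_ *: _]/(_ * _).
by rewrite (mulrC (v 0 i)) (mulrC (v 0 j)) (addrC (s p i j r * _)) (addrC (s p j i r * _)).
Qed.

(** The product rule leaves, besides the stated sum, exactly the terms of Schlaefli's formula, which
    cancel. *)
Lemma is_derive_HE r v : warped_domain p r ->
  is_derive r v (HE p) (\sum_i v 0 i * kappa p i r).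
Proof.
move=> rW.
have Dl i j : is_derive r v (lambda p i j) ('D_v (lambda p i j) r).
  by apply: derivableP; exact: (@ex_derive _ _ _ _ _ _ _ (is_derive_lambda v rW i j)).
have Dk i : is_derive r v (kappa p i) ('D_v (kappa p i) r).
  by apply: derivableP; exact: (@ex_derive _ _ _ _ _ _ _ (is_derive_kappa v rW i)).
have D1 : is_derive r v (fun x => \sum_i x 0 i * kappa p i x)
    (\sum_i (r 0 i * 'D_v (kappa p i) r + kappa p i r * v 0 i)).
  by apply: is_derive_bigsum => i _; exact: (is_deriveM (is_derive_coord r v i) (Dk i)).
have D2 : is_derive r v
    (fun x => \sum_(i < n) \sum_(j < n | (i < j)%N && edge p i j) ell p i j * lambda p i j x)
    (\sum_(i < n) \sum_(j < n | (i < j)%N && edge p i j) ell p i j * 'D_v (lambda p i j) r).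
  by apply: is_derive_bigsum => i _; apply: is_derive_bigsum => j _.
apply: (is_derive_eq (is_deriveD D1 D2)).
rewrite big_split/= addrAC [X in _ + X = _](eq_bigr (fun i => v 0 i * kappa p i r)); last first.
  by move=> i _; rewrite mulrC.
rewrite -[RHS]add0r; congr (_ + _).
(* Each [ell p i j] is split by [ell_s] into one share for each end of the edge; at every vertex
   [derive_kappa] then gives zero. *)
transitivity (\sum_(i < n) r 0 i * 'D_v (kappa p i) r +
    \sum_(i < n) \sum_(j < n | edge p i j) r 0 i * s p i j r * 'D_v (lambda p i j) r).
  congr (_ + _); rewrite -sum_edges; apply: eq_bigr => i _; apply: eq_bigr => j /andP[_ eij].
  by rewrite -(ell_s rW eij) (lambdaC j i) mulrDl.
rewrite -big_split/= big1// => i _; rewrite (derive_kappa v rW) mulrN mulr_sumr addrC.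
by under eq_bigr do rewrite -mulrA; rewrite subrr.
Qed.

Lemma sum_derive_kappa r v : warped_domain p r ->
  \sum_i v 0 i * 'D_v (kappa p i) r =
  \sum_i r 0 i * \sum_(j | edge p i j) 'D_v (s p i j) r * 'D_v (lambda p i j) r.
Proof.
move=> rW; apply/eqP; rewrite eq_sym -subr_eq0 -sumrB; apply/eqP.
(* By symmetry of [lambda], the two terms of an edge share the factor derived from [lambda]; the sum
   of their other factors is zero by [derive_ell_s]. *)
transitivity (\sum_(i < n) \sum_(j < n | edge p i j)
    (v 0 i * s p i j r + r 0 i * 'D_v (s p i j) r) * 'D_v (lambda p i j) r).
  apply: eq_bigr => i _; rewrite (derive_kappa v rW) mulrN opprK !mulr_sumr -big_split/=.
  by apply: eq_bigr => j _; ring.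
rewrite -sum_edges big1// => i _; rewrite big1// => j /andP[_ eij].
by rewrite (lambdaC j i) -mulrDl derive_ell_s// mul0r.
Qed.

End WarpedPolyhedron.

(** The neighborhood U is the whole [warped_domain]. Derivability is asserted separately because
    ['D_rdot] is a total operator. *)
Theorem lemma3p14 (R : realType) (n : nat) (p : 'I_n -> 'rV[R]_3)
    (Ptri : triangular_polyhedron p) (P0 : interior (polytope p) 0) :
  open_nbhs (r0 p) (warped_domain p) /\
  forall r rdot : 'rV[R]_n, warped_domain p r ->
    [/\ forall i, derivable (kappa p i) r rdot,
        forall i j, edge p i j ->
          derivable (s p i j) r rdot /\ derivable (lambda p i j) r rdot,
        is_second_derive (fun t : R => HE p (r + t *: rdot)) 0
          (\sum_i rdot 0 i * 'D_rdot (kappa p i) r)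
      & is_second_derive (fun t : R => HE p (r + t *: rdot)) 0
          (\sum_i r 0 i *
             \sum_(j | edge p i j) 'D_rdot (s p i j) r * 'D_rdot (lambda p i j) r)].
Proof.
split; first by split; [exact: warped_domain_open | exact: warped_domain_r0].
move=> r v rW.
have Dk i : derivable (kappa p i) r v.
  exact: (@ex_derive _ _ _ _ _ _ _ (is_derive_kappa P0 v rW i)).
have main : is_second_derive (fun t : R => HE p (r + t *: v)) 0
    (\sum_i v 0 i * 'D_v (kappa p i) r).
  (* The first derivative has to be known for all small [t], and not only at 0, before it can be
     differentiated again. *)
  have line_dom : \forall t \near (0 : R), warped_domain p (r + t *: v).
    have : (fun t : R => r + t *: v) @ (0 : R) --> r + 0 *: v.
      by apply: cvgD; [exact: cvg_cst | apply: cvgZr_tmp; exact: cvg_id].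
    by rewrite scale0r addr0; apply; exact: near_warped_domain.
  have D t : warped_domain p (r + t *: v) ->
      is_derive t 1 (fun t => HE p (r + t *: v)) (\sum_i v 0 i * kappa p i (r + t *: v)).
    by move=> tW; apply/is_derive_lineP; exact: is_derive_HE.
  split.
    by apply: filterS line_dom => t /D Dt; exact: (@ex_derive _ _ _ _ _ _ _ Dt).
  have Dsum : is_derive (0 : R) 1 (fun t : R => \sum_i v 0 i * kappa p i (r + t *: v))
      (\sum_i v 0 i * 'D_v (kappa p i) r).
    apply: is_derive_bigsum => i _.
    have Dki : is_derive (0 : R) 1 (fun t : R => kappa p i (r + t *: v)) ('D_v (kappa p i) r).
      by apply/is_derive_line0; exact: derivableP.
    exact: (is_deriveZ (v 0 i) Dki).
  have near1 : \forall t \near (0 : R), \sum_i v 0 i * kappa p i (r + t *: v) =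
      derive1 (fun t : R => HE p (r + t *: v)) t.
    by apply: filterS line_dom => t /D Dt; rewrite derive1E (@derive_val _ _ _ _ _ _ _ Dt).
  exact: (near_eq_is_derive near1 Dsum).
split=> //.
  move=> i j eij; split; first exact: derivable_s.
  exact: (@ex_derive _ _ _ _ _ _ _ (is_derive_lambda P0 v rW i j)).
by rewrite -sum_derive_kappa.
Qed.
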